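(* Let $n\ge 2$, let $R$ be a commutative ring with unit, let $F_n$ be a free group of rank $n$, and let $\widehat T$, $\widehat T_p$, $\Theta_n$, $IA(\widehat T)$, $\widehat{R[F_n]}$ and $\widehat{I_R[F_n]^p}$ be as in the context. (1) For any $R$-valued Magnus expansion $\theta\in\Theta_n$, the induced homomorphism $\theta:\widehat{R[F_n]}\to\widehat T$ is an $R$-algebra isomorphism, which maps $\widehat{I_R[F_n]^p}$ onto $\widehat T_p$ for each $p\ge 1$. (2) If $\theta',\theta''\in\Theta_n$, then there exists a unique $U\in IA(\widehat T)$ such that $\theta''=U\circ\theta'$. In other words, the action of the group $IA(\widehat T)$ on the set $\Theta_n$ given by $(U,\theta)\mapsto U\circ\theta$ is free and transitive.
   Context: $R$ is a commutative ring with unit and $F_n=\langle x_1,\dots,x_n\rangle$ is a free group of rank $n\ge2$. $H=H_1(F_n;R)=F_n^{\mathrm{abel}}\otimes_{\mathbb Z}R\cong R^n$; for $\gamma\in F_n$, $[\gamma]\in H$ denotes its class. All tensor products are over $R$. $\widehat T=\prod_{m\ge0}H^{\otimes m}$ is the completed tensor algebra, with two-sided ideals $\widehat T_p=\prod_{m\ge p}H^{\otimes m}$, $p\ge1$. The set $1+\widehat T_1$ is a subgroup of the multiplicative group of $\widehat T$. An ($R$-valued) Magnus expansion of $F_n$ is a group homomorphism $\theta:F_n\to1+\widehat T_1$ such that $\theta(\gamma)\equiv1+[\gamma]\pmod{\widehat T_2}$ for every $\gamma\in F_n$. $\Theta_n$ is the set of all $R$-valued Magnus expansions. $\mathrm{Aut}(\widehat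 T)$ is the group of $R$-algebra automorphisms $U$ of $\widehat T$ with $U(\widehat T_p)=\widehat T_p$ for all $p\ge1$; $|U|\in GL(H)$ is the automorphism induced by $U$ on $\widehat T_1/\widehat T_2=H$; $IA(\widehat T)$ is the kernel of $U\mapsto|U|$. Let $I_R[F_n]\subset R[F_n]$ be the augmentation ideal. $\widehat{R[F_n]}=\varprojlim_m R[F_n]/I_R[F_n]^m$ and $\widehat{I_R[F_n]^p}=\varprojlim_{m\ge p}I_R[F_n]^p/I_R[F_n]^m$. A Magnus expansion $\theta$ extends $R$-linearly to $R[F_n]\to\widehat T$ and maps $I_R[F_n]$ into $\widehat T_1$, hence induces an $R$-algebra homomorphism, again denoted $\theta:\widehat{R[F_n]}\to\widehat T$. *)

(* Defs.v *)
From HB Require Import structures.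
From mathcomp Require Import all_boot all_algebra.
From mathcomp Require Import boolp classical_sets finmap monalg.

Set Implicit Arguments.
Unset Strict Implicit.
Unset Printing Implicit Defensive.

Import GRing.Theory.
Local Open Scope ring_scope.
Local Open Scope quotient_scope.
Local Open Scope classical_set_scope.

(* R may be the zero ring, and R[F]/I^0 is always the zero ring, whereas       *)
(* MathComp's algType requires 1 != 0. The R-algebras below are therefore      *)
(* types with both a pzRingType and an lmodType R structure, such that         *)
(* *: and * are compatible.                                                    *)

Definition freemod (R : comPzRingType) (X : choiceType) := {malg R[X]}.
HB.instance Definition _ (R : comPzRingType) (X : choiceType) :=
  GRing.Zmodule.on (freemod R X).

Section FreeModule.
Context {R : comPzRingType} {X : choiceType}.
Implicit Types (g : freemod R X) (c : R).

Definition fmscale c g : freemod R X := [malg k in msupp g => c * mcoeff k g].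

Lemma fmscaleE c g k : mcoeff k (fmscale c g) = c * mcoeff k g.
Proof. by rewrite mcoeffE; case: msuppP => // _; rewrite mulr0. Qed.

Lemma fmscaleA a b g : fmscale a (fmscale b g) = fmscale (a * b) g.
Proof. by apply/malgP=> k; rewrite !fmscaleE mulrA. Qed.

Lemma fmscale1 : left_id 1 fmscale.
Proof. by move=> g; apply/malgP=> k; rewrite fmscaleE mul1r. Qed.

Lemma fmscaleDr : right_distributive fmscale +%R.
Proof.
move=> c g h; apply/malgP=> k.
by rewrite fmscaleE !mcoeffD !fmscaleE mulrDr.
Qed.

Lemma fmscaleDl g : {morph fmscale^~ g : a b / a + b}.
Proof.
by move=> a b /=; apply/malgP=> k; rewrite mcoeffD !fmscaleE mulrDl.
Qed.

HB.instance Definition _ := GRing.Zmodule_isLmodule.Build R (freemod R X)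
  fmscaleA fmscale1 fmscaleDr fmscaleDl.

Definition fmgen (k : X) : freemod R X := mkmalgU k 1.

Lemma fmscale_gen c k : c *: fmgen k = mkmalgU k c.
Proof.
by apply/malgP=> l; rewrite fmscaleE !mcoeffU mulrnAr mulr1.
Qed.

Lemma fmE g : g = \sum_(k <- msupp g) mcoeff k g *: fmgen k.
Proof. by rewrite {1}(monalgE g); apply: eq_bigr => k _; rewrite fmscale_gen. Qed.

Lemma fm_ind (P : freemod R X -> Prop) :
  P 0 -> (forall c k g, P g -> P (c *: fmgen k + g)) -> forall g, P g.
Proof.
move=> P0 PS g; rewrite [g]fmE.
elim: (X in \sum_(k <- X) _) => [|k s IHs]; first by rewrite big_nil.
by rewrite big_cons; apply: PS.
Qed.

End FreeModule.

Section LinearExtension.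
Context {R : comPzRingType} {X : choiceType} {V : lmodType R} (f : X -> V).
Implicit Types (g : freemod R X) (c : R).

Definition fmlift g : V := \sum_(k <- msupp g) mcoeff k g *: f k.

Lemma fmliftEw (d : {fset X}) g : (msupp g `<=` d)%fset ->
  fmlift g = \sum_(k <- d) mcoeff k g *: f k.
Proof.
move=> le; rewrite /fmlift; apply/(big_fset_incl _ le) => k _.
by move=> /mcoeff_outdom ->; rewrite scale0r.
Qed.

Lemma fmlift_is_linear : linear fmlift.
Proof.
move=> c g h; set u := c *: g + h.
pose d := (msupp g `|` msupp h `|` msupp u)%fset.
have sg : (msupp g `<=` d)%fset.
  by apply/fsubsetP=> k kg; rewrite !in_fsetU kg.
have sh : (msupp h `<=` d)%fset.
  by apply/fsubsetP=> k kh; rewrite !in_fsetU kh orbT.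
have su : (msupp u `<=` d)%fset.
  by apply/fsubsetP=> k ku; rewrite !in_fsetU ku orbT.
rewrite (fmliftEw sg) (fmliftEw sh) (fmliftEw su) scaler_sumr -big_split /=.
by apply: eq_bigr => k _; rewrite mcoeffD fmscaleE scalerDl scalerA.
Qed.

HB.instance Definition _ :=
  GRing.isLinear.Build R (freemod R X) V *:%R fmlift fmlift_is_linear.

Lemma fmlift_gen k : fmlift (fmgen k) = f k.
Proof.
rewrite (fmliftEw msuppU_le) big_seq_fset1 mcoeffUU.
exact: scale1r.
Qed.

End LinearExtension.

Section MonoidAlgebra.
Context {R : comPzRingType} {M : monoidType}.
Local Notation A := (freemod R M).
Implicit Types (g h u : A) (c : R).

Definition mamul g h : A :=
  fmlift (fun k => fmlift (fun l => fmgen (k * l)%g : A) h) g.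

Lemma mamulDl : left_distributive mamul +%R.
Proof. by move=> g h u; rewrite /mamul linearD. Qed.

Lemma mamulZl c g h : mamul (c *: g) h = c *: mamul g h.
Proof. by rewrite /mamul linearZ. Qed.

Lemma mamul_gen k h : mamul (fmgen k) h = fmlift (fun l => fmgen (k * l)%g : A) h.
Proof. by rewrite /mamul fmlift_gen. Qed.

Lemma mamul0l h : mamul 0 h = 0.
Proof. by rewrite /mamul linear0. Qed.

Lemma mamulDr : right_distributive mamul +%R.
Proof.
move=> g h u; elim/(@fm_ind R M): g => [|c k g IH]; first by rewrite !mamul0l addr0.
by rewrite !mamulDl !mamulZl IH !mamul_gen linearD scalerDr addrACA.
Qed.

Lemma mamulZr c g h : mamul g (c *: h) = c *: mamul g h.
Proof.
elim/(@fm_ind R M): g => [|b k g IH]; first by rewrite !mamul0l scaler0.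
by rewrite !mamulDl !mamulZl IH !mamul_gen linearZ /= scalerDr !scalerA mulrC.
Qed.

Lemma mamul0r g : mamul g 0 = 0.
Proof. by rewrite -(scale0r (0 : A)) mamulZr !scale0r. Qed.

Lemma mamul_gengen k l : mamul (fmgen k) (fmgen l) = fmgen (k * l)%g.
Proof. by rewrite mamul_gen fmlift_gen. Qed.

Lemma mamulA : associative mamul.
Proof.
move=> g h u; elim/(@fm_ind R M): g => [|c k g IHg]; first by rewrite !mamul0l.
rewrite mamulDl mamulZl mamulDl mamulZl mamulDl mamulZl IHg.
suff -> : mamul (fmgen k) (mamul h u) = mamul (mamul (fmgen k) h) u by [].
elim/(@fm_ind R M): h {IHg} => [|b l h IHh]; first by rewrite !(mamul0l, mamul0r).
rewrite mamulDl mamulZl [in RHS]mamulDr [in RHS]mamulZr mamulDr mamulZr.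
rewrite mamulDl mamulZl IHh.
suff -> : mamul (fmgen k) (mamul (fmgen l) u) =
  mamul (mamul (fmgen k) (fmgen l)) u by [].
elim/(@fm_ind R M): u {IHh} => [|a m u IHu]; first by rewrite !mamul0r.
by rewrite !(mamulDr, mamulZr) IHu !mamul_gengen mulgA.
Qed.

Lemma mamul1l : left_id (fmgen 1%g) mamul.
Proof.
move=> g; elim/(@fm_ind R M): g => [|c k g IH]; first exact: mamul0r.
by rewrite mamulDr mamulZr IH mamul_gengen mul1g.
Qed.

Lemma mamul1r : right_id (fmgen 1%g) mamul.
Proof.
move=> g; elim/(@fm_ind R M): g => [|c k g IH]; first exact: mamul0l.
by rewrite mamulDl mamulZl IH mamul_gengen mulg1.
Qed.

HB.instance Definition _ := GRing.Zmodule_isPzRing.Build (freemod R M)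
  mamulA mamul1l mamul1r mamulDl mamulDr.

Lemma fmgenM k l : fmgen (k * l)%g = fmgen k * fmgen l :> A.
Proof. exact/esym/mamul_gengen. Qed.

Lemma fm_scalerAl c g h : c *: (g * h) = (c *: g) * h.
Proof. exact/esym/mamulZl. Qed.

Lemma fm_scalerAr c g h : c *: (g * h) = g * (c *: h).
Proof. exact/esym/mamulZr. Qed.

End MonoidAlgebra.

Section QuotientModule.
Context {R : comPzRingType} {V : lmodType R}.

Record submodule := Submodule {
  submem :> V -> Prop;
  submem0 : submem 0;
  submemD : forall u v, submem u -> submem v -> submem (u + v);
  submemZ : forall c v, submem v -> submem (c *: v)
}.

Inductive lspan (S : V -> Prop) : V -> Prop :=
  | lspan0 : lspan S 0
  | lspanS c s v : S s -> lspan S v -> lspan S (c *: s + v).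

Lemma lspanD S u v : lspan S u -> lspan S v -> lspan S (u + v).
Proof.
by elim=> [|c s w Ss _ IH] Sv; rewrite ?add0r // -addrA; apply: lspanS (IH Sv).
Qed.

Lemma lspanZ S c v : lspan S v -> lspan S (c *: v).
Proof.
elim=> [|b s w Ss _ IH]; first by rewrite scaler0; apply: lspan0.
by rewrite scalerDr scalerA; apply: lspanS.
Qed.

Definition lspan_submodule S :=
  Submodule (lspan0 S) (@lspanD S) (@lspanZ S).

Definition submodule_pred (N : submodule) : {pred V} := fun v => `[< N v >].

Context (N : submodule).

Lemma submodule_zmod_closed : zmod_closed (submodule_pred N).
Proof.
split=> [|u v /asboolP Nu /asboolP Nv]; first exact/asboolP/submem0.
by apply/asboolP/submemD => //; rewrite -scaleN1r; apply: submemZ.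
Qed.

HB.instance Definition _ :=
  GRing.isZmodClosed.Build V (submodule_pred N) submodule_zmod_closed.

Definition quotmod := Quotient.quot (submodule_pred N).
HB.instance Definition _ := GRing.Zmodule.on quotmod.

Definition qpi (v : V) : quotmod := \pi_(Quotient.quot (submodule_pred N)) v.
Definition qrepr (q : quotmod) : V :=
  repr (q : Quotient.quot (submodule_pred N)).

Lemma qreprK q : qpi (qrepr q) = q.
Proof. exact: reprK. Qed.

Lemma qpi_eq u v : qpi u = qpi v <-> N (u - v).
Proof.
rewrite /qpi; split=> [/eqP|Nuv].
  by rewrite -Quotient.idealrBE => /asboolP.
by apply/eqP; rewrite -Quotient.idealrBE; apply/asboolP.
Qed.

Lemma qpi_repr v : N (qrepr (qpi v) - v).
Proof. by apply/qpi_eq; rewrite qreprK. Qed.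

Lemma qpiD : {morph qpi : u v / u + v}.
Proof. by move=> u v; rewrite /qpi raddfD. Qed.

Definition qscale (c : R) (q : quotmod) : quotmod := qpi (c *: qrepr q).

Lemma qscale_pi c v : qscale c (qpi v) = qpi (c *: v).
Proof. by apply/qpi_eq; rewrite -scalerBr; apply/submemZ/qpi_repr. Qed.

Lemma qscaleA a b q : qscale a (qscale b q) = qscale (a * b) q.
Proof. by rewrite -[q]qreprK !qscale_pi scalerA. Qed.

Lemma qscale1 : left_id 1 qscale.
Proof. by move=> q; rewrite -[q]qreprK qscale_pi scale1r. Qed.

Lemma qscaleDr : right_distributive qscale +%R.
Proof.
move=> c p q; rewrite -[p]qreprK -[q]qreprK -qpiD !qscale_pi.
by rewrite scalerDr qpiD.
Qed.

Lemma qscaleDl q : {morph qscale^~ q : a b / a + b}.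
Proof. by move=> a b /=; rewrite -[q]qreprK !qscale_pi scalerDl qpiD. Qed.

HB.instance Definition _ := GRing.Zmodule_isLmodule.Build R quotmod
  qscaleA qscale1 qscaleDr qscaleDl.

Lemma qpi_is_linear : linear qpi.
Proof. by move=> c u v; rewrite qpiD -qscale_pi. Qed.

HB.instance Definition _ :=
  GRing.isLinear.Build R V quotmod *:%R qpi qpi_is_linear.

End QuotientModule.
Arguments submodule {R} V.

Section QuotientAlgebra.
Context {R : comPzRingType} {M : monoidType}.
Local Notation A := (freemod R M).

Record ideal := Ideal {
  ideal_submodule :> submodule A;
  idealMl : forall a u : A, ideal_submodule u -> ideal_submodule (a * u);
  idealMr : forall a u : A, ideal_submodule u -> ideal_submodule (u * a)
}.

Inductive ispan (S : A -> Prop) : A -> Prop :=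
  | ispan0 : ispan S 0
  | ispanS a s b v : S s -> ispan S v -> ispan S (a * s * b + v).

Lemma ispanD S u v : ispan S u -> ispan S v -> ispan S (u + v).
Proof.
by elim=> [|a s b w Ss _ IH] Sv; rewrite ?add0r // -addrA; apply: ispanS (IH Sv).
Qed.

Lemma ispanZ S c v : ispan S v -> ispan S (c *: v).
Proof.
elim=> [|a s b w Ss _ IH]; first by rewrite scaler0; apply: ispan0.
by rewrite scalerDr !fm_scalerAl; apply: ispanS.
Qed.

Lemma ispanMl S a v : ispan S v -> ispan S (a * v).
Proof.
elim=> [|b s d w Ss _ IH]; first by rewrite mulr0; apply: ispan0.
by rewrite mulrDr !mulrA; apply: ispanS.
Qed.

Lemma ispanMr S a v : ispan S v -> ispan S (v * a).
Proof.
elim=> [|b s d w Ss _ IH]; first by rewrite mul0r; apply: ispan0.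
by rewrite mulrDl -mulrA; apply: ispanS.
Qed.

Definition ideal_span (S : A -> Prop) : ideal :=
  @Ideal (Submodule (ispan0 S) (@ispanD S) (@ispanZ S))
         (@ispanMl S) (@ispanMr S).

Definition ideal_full : ideal :=
  @Ideal (@Submodule R A (fun=> True) I (fun _ _ _ _ => I) (fun _ _ _ => I))
         (fun _ _ _ => I) (fun _ _ _ => I).

Fixpoint ideal_exp (J : ideal) (m : nat) : ideal :=
  if m is m'.+1 then
    ideal_span [set z | exists x y, [/\ J x, ideal_exp J m' y & z = x * y]]
  else ideal_full.

Lemma ispan_sub (S S' : A -> Prop) : S `<=` S' -> ispan S `<=` ispan S'.
Proof.
move=> SS' v; elim=> [|a s b w Ss _ IH]; first exact: ispan0.
by apply: ispanS => //; apply: SS'.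
Qed.

Lemma ideal_expS (J : ideal) m : ideal_exp J m.+1 `<=` ideal_exp J m.
Proof.
elim: m => [//|m IH]; apply: ispan_sub => _ [x [y [Jx Jy ->]]].
by exists x, y; split=> //; apply: IH.
Qed.

Definition quotalg (J : ideal) := quotmod J.
HB.instance Definition _ (J : ideal) := GRing.Lmodule.on (quotalg J).

Section QuotientRing.
Context (J : ideal).
Implicit Types (p q : quotalg J) (u v : A).

Definition qone : quotalg J := qpi J 1.
Definition qmul p q : quotalg J := qpi J (qrepr p * qrepr q).

Lemma qmul_pi u v : qmul (qpi J u) (qpi J v) = qpi J (u * v).
Proof.
apply/qpi_eq; set a := qrepr _; set b := qrepr _.
have -> : a * b - u * v = (a - u) * b + u * (b - v).
  by rewrite mulrBl mulrBr addrA subrK.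
by apply: submemD; [apply: idealMr|apply: idealMl]; apply: qpi_repr.
Qed.

Lemma qmulA : associative qmul.
Proof.
by move=> p q r; rewrite -[p]qreprK -[q]qreprK -[r]qreprK !qmul_pi mulrA.
Qed.

Lemma qmul1l : left_id qone qmul.
Proof. by move=> q; rewrite -[q]qreprK qmul_pi mul1r. Qed.

Lemma qmul1r : right_id qone qmul.
Proof. by move=> q; rewrite -[q]qreprK qmul_pi mulr1. Qed.

Lemma qmulDl : left_distributive qmul +%R.
Proof.
move=> p q r; rewrite -[p]qreprK -[q]qreprK -[r]qreprK.
by rewrite -qpiD !qmul_pi mulrDl qpiD.
Qed.

Lemma qmulDr : right_distributive qmul +%R.
Proof.
move=> p q r; rewrite -[p]qreprK -[q]qreprK -[r]qreprK.
by rewrite -qpiD !qmul_pi mulrDr qpiD.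
Qed.

HB.instance Definition _ := GRing.Zmodule_isPzRing.Build (quotalg J)
  qmulA qmul1l qmul1r qmulDl qmulDr.

Definition qapi (u : A) : quotalg J := qpi J u.
HB.instance Definition _ := GRing.Linear.copy qapi (qpi J).

Lemma qapiK q : qapi (qrepr q) = q. Proof. exact: qreprK. Qed.

Lemma qapi_eq u v : qapi u = qapi v <-> J (u - v).
Proof. exact: qpi_eq. Qed.

Lemma qapi_is_monoid_morphism : GRing.monoid_morphism qapi.
Proof. split=> [|u v]; first by []. exact/esym/qmul_pi. Qed.

HB.instance Definition _ := GRing.isMonoidMorphism.Build A (quotalg J) qapi
  qapi_is_monoid_morphism.

Lemma qapiZ c u : qapi (c *: u) = c *: qapi u. Proof. exact: linearZ. Qed.
Lemma qapiM u v : qapi (u * v) = qapi u * qapi v. Proof. exact: rmorphM. Qed.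

Lemma qa_scalerAl c p q : c *: (p * q) = (c *: p) * q.
Proof.
by rewrite -[p]qapiK -[q]qapiK -qapiZ -!qapiM -qapiZ fm_scalerAl.
Qed.

Lemma qa_scalerAr c p q : c *: (p * q) = p * (c *: q).
Proof.
by rewrite -[p]qapiK -[q]qapiK -qapiZ -!qapiM -qapiZ fm_scalerAr.
Qed.

End QuotientRing.

End QuotientAlgebra.
Arguments ideal R M : clear implicits.

(* The inverse limit of the algebras A / J_m, where A is a monoid algebra and  *)
(* J_0, J_1, ... is a decreasing sequence of two-sided ideals.                 *)
Section Completion.
Context {R : comPzRingType} {M : monoidType}.
Local Notation A := (freemod R M).

Record filtration := Filtration {
  filt_ideal :> nat -> ideal R M;
  filtS : forall m, filt_ideal m.+1 `<=` filt_ideal m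
}.

Context (J : filtration).

Definition qtrans m (q : quotalg (J m.+1)) : quotalg (J m) :=
  qapi (J m) (qrepr q).

Lemma qtrans_pi m u : qtrans (qapi (J m.+1) u) = qapi (J m) u.
Proof. by apply/qapi_eq/filtS/qpi_repr. Qed.

Record completion := Completion {
  cproj :> forall m, quotalg (J m);
  cprojS : forall m, qtrans (cproj m.+1) = cproj m
}.

HB.instance Definition _ := gen_eqMixin completion.
HB.instance Definition _ := gen_choiceMixin completion.

Implicit Types a b d : completion.

Lemma completionP a b : (forall m, a m = b m) -> a = b.
Proof.
case: a b => [a ca] [b cb] /= eqab.
have {eqab} E : a = b by apply: functional_extensionality_dep.
by case: _ / E cb => cb; congr Completion; apply: Prop_irrelevance.
Qed.

Lemma cprojP a m : exists2 u, a m = qapi (J m) u & a m.+1 = qapi (J m.+1) u.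
Proof.
exists (qrepr (a m.+1)); last by rewrite qapiK.
by rewrite -qtrans_pi qapiK cprojS.
Qed.

Fact czero_subproof m : qtrans (0 : quotalg (J m.+1)) = 0.
Proof. by rewrite -(linear0 (qapi (J m.+1))) qtrans_pi linear0. Qed.
Definition czero := Completion czero_subproof.

Fact cone_subproof m : qtrans (1 : quotalg (J m.+1)) = 1.
Proof. by rewrite -(rmorph1 (qapi (J m.+1))) qtrans_pi rmorph1. Qed.
Definition cone := Completion cone_subproof.

Fact cadd_subproof a b m : qtrans (a m.+1 + b m.+1) = a m + b m.
Proof.
have [u -> ->] := cprojP a m; have [v -> ->] := cprojP b m.
by rewrite -!linearD qtrans_pi.
Qed.
Definition cadd a b := Completion (cadd_subproof a b).

Fact copp_subproof a m : qtrans (- a m.+1) = - a m.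
Proof. by have [u -> ->] := cprojP a m; rewrite -!linearN qtrans_pi. Qed.
Definition copp a := Completion (copp_subproof a).

Fact cmul_subproof a b m : qtrans (a m.+1 * b m.+1) = a m * b m.
Proof.
have [u -> ->] := cprojP a m; have [v -> ->] := cprojP b m.
by rewrite -!qapiM qtrans_pi.
Qed.
Definition cmul a b := Completion (cmul_subproof a b).

Fact cscale_subproof c a m : qtrans (c *: a m.+1) = c *: a m.
Proof. by have [u -> ->] := cprojP a m; rewrite -!qapiZ qtrans_pi. Qed.
Definition cscale c a := Completion (cscale_subproof c a).

Lemma caddA : associative cadd.
Proof. by move=> a b d; apply: completionP => m; apply: addrA. Qed.
Lemma caddC : commutative cadd.
Proof. by move=> a b; apply: completionP => m; apply: addrC. Qed.
Lemma cadd0 : left_id czero cadd.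
Proof. by move=> a; apply: completionP => m; apply: add0r. Qed.
Lemma caddN : left_inverse czero copp cadd.
Proof. by move=> a; apply: completionP => m; apply: addNr. Qed.

HB.instance Definition _ :=
  GRing.isZmodule.Build completion caddA caddC cadd0 caddN.

Lemma cmulA : associative cmul.
Proof. by move=> a b d; apply: completionP => m; apply: mulrA. Qed.
Lemma cmul1l : left_id cone cmul.
Proof. by move=> a; apply: completionP => m; apply: mul1r. Qed.
Lemma cmul1r : right_id cone cmul.
Proof. by move=> a; apply: completionP => m; apply: mulr1. Qed.
Lemma cmulDl : left_distributive cmul cadd.
Proof. by move=> a b d; apply: completionP => m; apply: mulrDl. Qed.
Lemma cmulDr : right_distributive cmul cadd.
Proof. by move=> a b d; apply: completionP => m; apply: mulrDr. Qed.

HB.instance Definition _ := GRing.Zmodule_isPzRing.Build completion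
  cmulA cmul1l cmul1r cmulDl cmulDr.

Lemma cscaleA x y a : cscale x (cscale y a) = cscale (x * y) a.
Proof. by apply: completionP => m; apply: scalerA. Qed.
Lemma cscale1 : left_id 1 cscale.
Proof. by move=> a; apply: completionP => m; apply: scale1r. Qed.
Lemma cscaleDr : right_distributive cscale cadd.
Proof. by move=> x a b; apply: completionP => m; apply: scalerDr. Qed.
Lemma cscaleDl a : {morph cscale^~ a : x y / x + y >-> cadd x y}.
Proof. by move=> x y; apply: completionP => m; apply: scalerDl. Qed.

HB.instance Definition _ := GRing.Zmodule_isLmodule.Build R completion
  cscaleA cscale1 cscaleDr cscaleDl.

Lemma completion_scalerAl x a b : x *: (a * b) = (x *: a) * b.
Proof. by apply: completionP => m; apply: qa_scalerAl. Qed.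
Lemma completion_scalerAr x a b : x *: (a * b) = a * (x *: b).
Proof. by apply: completionP => m; apply: qa_scalerAr. Qed.

(* The limit over m >= p of J_p / J_m, inside the limit of the A / J_m.        *)
Definition completion_filt (p : nat) : set completion :=
  [set a | forall m, (p <= m)%N -> exists2 u, J p u & a m = qapi (J m) u].

End Completion.

Section GroupRing.
Context (R : comPzRingType) (G : groupType).
Local Notation RG := (freemod R G).

Definition augmentation (u : RG) : R := \sum_(k <- msupp u) mcoeff k u.

Lemma augmentationE u : augmentation u =
  mcoeff tt (fmlift (fun=> fmgen tt : freemod R unit) u).
Proof.
rewrite /fmlift raddf_sum; apply: eq_bigr => k _ /=.
by rewrite fmscaleE mcoeffUU mulr1.
Qed.

Lemma augmentationD u v : augmentation (u + v) = augmentation u + augmentation v.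
Proof. by rewrite !augmentationE linearD mcoeffD. Qed.

Lemma augmentationZ c u : augmentation (c *: u) = c * augmentation u.
Proof. by rewrite !augmentationE linearZ fmscaleE. Qed.

Lemma augmentation0 : augmentation 0 = 0.
Proof. by rewrite !augmentationE linear0 mcoeff0. Qed.

Lemma augmentation_gen k : augmentation (fmgen k) = 1.
Proof. by rewrite augmentationE fmlift_gen mcoeffUU. Qed.

Lemma augmentationM u v : augmentation (u * v) = augmentation u * augmentation v.
Proof.
elim/(@fm_ind R G): u => [|c k u IH]; first by rewrite mul0r augmentation0 mul0r.
rewrite mulrDl !augmentationD IH mulrDl; congr (_ + _) => {IH}.
rewrite -fm_scalerAl !augmentationZ augmentation_gen mulr1; congr (_ * _).
elim/(@fm_ind R G): v => [|b l v IH]; first by rewrite mulr0.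
rewrite mulrDr !augmentationD IH -fm_scalerAr !augmentationZ -fmgenM.
by rewrite !augmentation_gen.
Qed.

Fact aug_idealD u v :
  augmentation u = 0 -> augmentation v = 0 -> augmentation (u + v) = 0.
Proof. by rewrite augmentationD => -> ->; rewrite addr0. Qed.
Fact aug_idealZ c v : augmentation v = 0 -> augmentation (c *: v) = 0.
Proof. by rewrite augmentationZ => ->; rewrite mulr0. Qed.
Fact aug_idealMl a u : augmentation u = 0 -> augmentation (a * u) = 0.
Proof. by rewrite augmentationM => ->; rewrite mulr0. Qed.
Fact aug_idealMr a u : augmentation u = 0 -> augmentation (u * a) = 0.
Proof. by rewrite augmentationM => ->; rewrite mul0r. Qed.

Definition aug_ideal : ideal R G :=
  @Ideal _ _ (Submodule augmentation0 aug_idealD aug_idealZ)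
         aug_idealMl aug_idealMr.

Definition aug_filtration : filtration :=
  Filtration (@ideal_expS _ _ aug_ideal).

Definition group_ring_hat := completion aug_filtration.
HB.instance Definition _ := GRing.PzRing.on group_ring_hat.
HB.instance Definition _ := GRing.Lmodule.on group_ring_hat.

Definition aug_ideal_hat (p : nat) : set group_ring_hat :=
  completion_filt (J := aug_filtration) p.

End GroupRing.

Definition words (X : Type) := seq X.
HB.instance Definition _ (X : choiceType) := Choice.on (words X).
HB.instance Definition _ (X : choiceType) :=
  isMonoid.Build (words X) (@catA X) (@cat0s X) (@cats0 X).

(* The tensor algebra of H: the free R-algebra on the set H modulo the         *)
(* R-linearity of the generators; tens [:: h_1; ...; h_m] is h_1 (x) ... (x)   *)
(* h_m, and tensor_power m is the summand of degree m of the tensor algebra.   *)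
Section TensorAlgebra.
Context {R : comPzRingType} (H : lmodType R).

Inductive tensor_relation : freemod R (words H) -> Prop :=
  | TensorRelation (c : R) (h h' : H) :
      tensor_relation (fmgen ([:: c *: h + h'] : words H)
        - (c *: fmgen ([:: h] : words H) + fmgen ([:: h'] : words H))).

Definition tensor_alg := quotalg (ideal_span tensor_relation).
HB.instance Definition _ := GRing.PzRing.on tensor_alg.
HB.instance Definition _ := GRing.Lmodule.on tensor_alg.

Definition tens (w : words H) : tensor_alg :=
  qapi (ideal_span tensor_relation) (fmgen w).

Definition tensor_power (m : nat) : submodule tensor_alg :=
  lspan_submodule [set t | exists w : words H, size w = m /\ t = tens w].

Lemma tens_mem w : tensor_power (size w) (tens w).
Proof.
rewrite -[tens w]addr0 -[tens w]scale1r.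
by apply: lspanS; [exists w|apply: lspan0].
Qed.

Lemma tens_cat (w w' : words H) : tens (w ++ w') = tens w * tens w'.
Proof. by rewrite /tens -[w ++ w']/(w * w')%g fmgenM qapiM. Qed.

Lemma tensor_powerM p q s t :
  tensor_power p s -> tensor_power q t -> tensor_power (p + q)%N (s * t).
Proof.
move=> Ss St; elim: Ss => [|c _ s' [w [sw ->]] _ IH].
  by rewrite mul0r; apply: lspan0.
rewrite mulrDl; apply: lspanD IH; rewrite -qa_scalerAl; apply: lspanZ.
elim: St => [|b _ t' [w' [sw' ->]] _ IH]; first by rewrite mulr0; apply: lspan0.
rewrite mulrDr; apply: lspanD IH; rewrite -qa_scalerAr; apply: lspanZ.
by rewrite -tens_cat -sw -sw' -size_cat; apply: tens_mem.
Qed.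

Lemma tensor_powerN m t : tensor_power m t -> tensor_power m (- t).
Proof. by rewrite -scaleN1r; apply: lspanZ. Qed.

Lemma tensor_power_sum m (I : Type) (r : seq I) (P : pred I) E :
  (forall i, P i -> tensor_power m (E i)) ->
  tensor_power m (\sum_(i <- r | P i) E i).
Proof. by move=> SE; elim/big_ind: _ => //; [apply: lspan0|apply: lspanD]. Qed.

End TensorAlgebra.

Section CompletedTensorAlgebra.
Context {R : comPzRingType} (H : lmodType R).
Local Notation T := (tensor_alg H).

Record tensor_hat := TensorHat {
  tcomp :> nat -> T;
  tcompP : forall m, tensor_power H m (tcomp m)
}.

HB.instance Definition _ := gen_eqMixin tensor_hat.
HB.instance Definition _ := gen_choiceMixin tensor_hat.

Implicit Types s t u : tensor_hat.

Lemma tensor_hatP s t : (forall m, s m = t m) -> s = t.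
Proof.
case: s t => [s Ss] [t St] /= eqst.
have {eqst} E : s = t by apply: functional_extensionality_dep.
by case: _ / E St => St; congr TensorHat; apply: Prop_irrelevance.
Qed.

Definition tzero := @TensorHat (fun=> 0) (fun m => lspan0 _).
Definition tadd s t :=
  @TensorHat (fun m => s m + t m) (fun m => lspanD (tcompP s m) (tcompP t m)).
Definition topp t :=
  @TensorHat (fun m => - t m) (fun m => tensor_powerN (tcompP t m)).
Definition tscale c t :=
  @TensorHat (fun m => c *: t m) (fun m => lspanZ c (tcompP t m)).

Lemma taddA : associative tadd.
Proof. by move=> s t u; apply: tensor_hatP => m; apply: addrA. Qed.
Lemma taddC : commutative tadd.
Proof. by move=> s t; apply: tensor_hatP => m; apply: addrC. Qed.
Lemma tadd0 : left_id tzero tadd.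
Proof. by move=> s; apply: tensor_hatP => m; apply: add0r. Qed.
Lemma taddN : left_inverse tzero topp tadd.
Proof. by move=> s; apply: tensor_hatP => m; apply: addNr. Qed.

HB.instance Definition _ :=
  GRing.isZmodule.Build tensor_hat taddA taddC tadd0 taddN.

Lemma tscaleA x y t : tscale x (tscale y t) = tscale (x * y) t.
Proof. by apply: tensor_hatP => m; apply: scalerA. Qed.
Lemma tscale1 : left_id 1 tscale.
Proof. by move=> t; apply: tensor_hatP => m; apply: scale1r. Qed.
Lemma tscaleDr : right_distributive tscale tadd.
Proof. by move=> x s t; apply: tensor_hatP => m; apply: scalerDr. Qed.
Lemma tscaleDl t : {morph tscale^~ t : x y / x + y >-> tadd x y}.
Proof. by move=> x y; apply: tensor_hatP => m; apply: scalerDl. Qed.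

HB.instance Definition _ := GRing.Zmodule_isLmodule.Build R tensor_hat
  tscaleA tscale1 tscaleDr tscaleDl.

Definition thomog_fun (d : nat) (x : T) (m : nat) : T := if m == d then x else 0.

Fact thomog_subproof d x : tensor_power H d x ->
  forall m, tensor_power H m (thomog_fun d x m).
Proof.
by move=> Sx m; rewrite /thomog_fun; case: eqP => [->|_] //; apply: lspan0.
Qed.

Definition thomog (w : words H) : tensor_hat :=
  TensorHat (thomog_subproof (tens_mem w)).

Fact tmul_subproof s t m :
  tensor_power H m (\sum_(i < m.+1) s i * t (m - i)%N).
Proof.
apply: tensor_power_sum => i _; rewrite -{1}(subnKC (leq_ord i)).
exact/tensor_powerM/tcompP/tcompP.
Qed.

Definition tmul s t := TensorHat (tmul_subproof s t).

Lemma tmulE_rev s t m : tmul s t m = \sum_(i < m.+1) s (m - i)%N * t i.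
Proof.
rewrite /= (reindex_inj rev_ord_inj) /=; apply: eq_bigr => i _.
by rewrite subSS subKn // leq_ord.
Qed.

Lemma tmulA : associative tmul.
Proof.
move=> s t u; apply: tensor_hatP => m; rewrite [RHS]tmulE_rev.
have mulE (x y : tensor_hat) p : tmul x y p = \sum_(i < p.+1) x i * y (p - i)%N.
  by [].
pose E j k := s j * (t (m - j - k)%N * u k).
rewrite [LHS]mulE.
transitivity (\sum_(j < m.+1) \sum_(k < m.+1 | (k <= m - j)%N) E j k).
  apply: eq_bigr => j _; rewrite tmulE_rev big_distrr /=.
  by rewrite (big_ord_narrow_leq (leq_subr _ _)).
rewrite (exchange_big_dep predT) //=; apply: eq_bigr => k _.
transitivity (\sum_(j < m.+1 | (j <= m - k)%N) E j k).
  apply: eq_bigl => j; rewrite -ltnS -(ltnS j) -!subSn ?leq_ord //.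
  by rewrite -subn_gt0 -(subn_gt0 j) -!subnDA addnC.
rewrite (big_ord_narrow_leq (leq_subr _ _)) big_distrl /=.
by apply: eq_bigr => j _; rewrite /E -!subnDA addnC mulrA.
Qed.

Lemma tmul1l : left_id (thomog [::]) tmul.
Proof.
move=> t; apply: tensor_hatP => m /=; rewrite big_ord_recl /= big1 => [|i _].
  by rewrite addr0 subn0 [X in X * _]/thomog_fun /= mul1r.
by rewrite /thomog_fun /= mul0r.
Qed.

Lemma tmul1r : right_id (thomog [::]) tmul.
Proof.
move=> t; apply: tensor_hatP => m; rewrite tmulE_rev big_ord_recl big1 => [|i _].
  by rewrite addr0 subn0 /= [X in _ * X]/thomog_fun /= mulr1.
by rewrite /= /thomog_fun /= mulr0.
Qed.

Lemma tmulDl : left_distributive tmul tadd.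
Proof.
move=> s t u; apply: tensor_hatP => m /=; rewrite -big_split /=.
by apply: eq_bigr => i _; rewrite mulrDl.
Qed.

Lemma tmulDr : right_distributive tmul tadd.
Proof.
move=> s t u; apply: tensor_hatP => m /=; rewrite -big_split /=.
by apply: eq_bigr => i _; rewrite mulrDr.
Qed.

HB.instance Definition _ := GRing.Zmodule_isPzRing.Build tensor_hat
  tmulA tmul1l tmul1r tmulDl tmulDr.

Lemma tensor_hat_scalerAl x s t : x *: (s * t) = (x *: s) * t.
Proof.
apply: tensor_hatP => m /=; rewrite scaler_sumr.
by apply: eq_bigr => i _; rewrite qa_scalerAl.
Qed.

Lemma tensor_hat_scalerAr x s t : x *: (s * t) = s * (x *: t).
Proof.
apply: tensor_hatP => m /=; rewrite scaler_sumr.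
by apply: eq_bigr => i _; rewrite qa_scalerAr.
Qed.

Definition tensor_hat_ideal (p : nat) : set tensor_hat :=
  [set t | forall m, (m < p)%N -> t m = 0].

Lemma tensor_hat_idealM p q s t : tensor_hat_ideal p s ->
  tensor_hat_ideal q t -> tensor_hat_ideal (p + q) (s * t).
Proof.
move=> Ss St m ltm; rewrite [LHS]/=; apply: big1 => i _.
case: (ltnP i p) => [/Ss ->|lepi]; first by rewrite mul0r.
rewrite St ?mulr0 // ltn_subLR ?leq_ord //.
by apply: leq_trans ltm _; rewrite leq_add2r.
Qed.

End CompletedTensorAlgebra.

Section Abelianization.
Context (G : groupType).

Inductive derived_subgroup : G -> Prop :=
  | derived_comm x y : derived_subgroup [~ x, y]%g
  | derived1 : derived_subgroup 1%g
  | derivedM x y :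
      derived_subgroup x -> derived_subgroup y -> derived_subgroup (x * y)%g
  | derivedV x : derived_subgroup x -> derived_subgroup (x^-1)%g.

Definition abel_equiv (x y : G) : bool := `[< derived_subgroup (x^-1 * y)%g >].

Lemma abel_equiv_is_equiv : equiv_class_of abel_equiv.
Proof.
split=> [x|x y|y x z]; first by apply/asboolP; rewrite mulVg; apply: derived1.
  by apply/asboolP/asboolP=> /derivedV; rewrite invgM invgK.
move=> /asboolP Dxy /asboolP Dyz; apply/asboolP.
by rewrite -[z](mulVKg y) mulgA; apply: derivedM.
Qed.

Canonical abel_equiv_equiv := EquivRelPack abel_equiv_is_equiv.
Canonical abel_equiv_encModRel := defaultEncModRel abel_equiv.

Definition abelianization := {eq_quot abel_equiv}.
HB.instance Definition _ := Choice.on abelianization.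

Definition abel (x : G) : abelianization := \pi_({eq_quot abel_equiv}) x.
Definition abel_repr (a : abelianization) : G :=
  repr (a : {eq_quot abel_equiv}).

Lemma abel_reprK a : abel (abel_repr a) = a. Proof. exact: reprK. Qed.

Lemma abel_eq x y : abel x = abel y <-> derived_subgroup (x^-1 * y)%g.
Proof. by split=> [/eqmodP/asboolP|Dxy]; last exact/eqmodP/asboolP. Qed.

Definition aadd (a b : abelianization) := abel (abel_repr a * abel_repr b)%g.
Definition aopp (a : abelianization) := abel (abel_repr a)^-1%g.

Lemma aadd_abel x y : aadd (abel x) (abel y) = abel (x * y)%g.
Proof.
rewrite /aadd; set x' := abel_repr _; set y' := abel_repr _.
have /abel_eq Dx : abel x' = abel x by rewrite abel_reprK.
have /abel_eq Dy : abel y' = abel y by rewrite abel_reprK.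
apply/abel_eq; set d := (x'^-1 * x)%g in Dx; set e := (y'^-1 * y)%g in Dy.
have -> : ((x' * y')^-1 * (x * y) = d * [~ d, y'] * e)%g.
  by rewrite invgM commgEl mulVKg conjgE -!mulgA mulVKg.
exact: derivedM (derivedM Dx (derived_comm d y')) Dy.
Qed.

Lemma aaddC : commutative aadd.
Proof.
move=> a b; rewrite -[a]abel_reprK -[b]abel_reprK !aadd_abel.
apply/abel_eq; rewrite invgM -!mulgA.
exact: (derived_comm (abel_repr b) (abel_repr a)).
Qed.

Lemma aaddA : associative aadd.
Proof.
move=> a b c; rewrite -[a]abel_reprK -[b]abel_reprK -[c]abel_reprK.
by rewrite !aadd_abel mulgA.
Qed.

Lemma aadd0 : left_id (abel 1%g) aadd.
Proof. by move=> a; rewrite -[a]abel_reprK aadd_abel mul1g. Qed.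

Lemma aaddN : left_inverse (abel 1%g) aopp aadd.
Proof. by move=> a; rewrite -[X in aadd _ X]abel_reprK aadd_abel mulVg. Qed.

HB.instance Definition _ :=
  GRing.isZmodule.Build abelianization aaddA aaddC aadd0 aaddN.

End Abelianization.

(* The tensor product of an abelian group A with R over the integers; R acts   *)
(* on the second factor.                                                       *)
Section TensorZ.
Context (A : zmodType) (R : comPzRingType).
Local Notation "a '⊗' r" := (fmgen ((a, r) : (A * R)%type) : freemod R (A * R)%type)
  (at level 40).

Inductive tensorZ_relation : freemod R (A * R)%type -> Prop :=
  | TensorZDl a b r : tensorZ_relation ((a + b) ⊗ r - (a ⊗ r + b ⊗ r))
  | TensorZDr a r s : tensorZ_relation (a ⊗ (r + s) - (a ⊗ r + a ⊗ s))
  | TensorZZ c a r : tensorZ_relation (a ⊗ (c * r) - c *: (a ⊗ r)).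

Definition tensorZ := quotmod (lspan_submodule tensorZ_relation).
HB.instance Definition _ := GRing.Lmodule.on tensorZ.

Definition tensorZ_pair (a : A) (r : R) : tensorZ := qpi _ (a ⊗ r).

End TensorZ.

Definition H1 (G : groupType) (R : comPzRingType) : lmodType R :=
  tensorZ (abelianization G) R.

Definition H1_class {G : groupType} (R : comPzRingType) (x : G) : H1 G R :=
  tensorZ_pair (abel x) 1.

Definition free_on (F : groupType) (n : nat) (x : 'I_n -> F) : Prop :=
  forall (G : groupType) (y : 'I_n -> G),
    exists! f : F -> G, {morph f : a b / (a * b)%g} /\ forall i, f (x i) = y i.

Section Magnus.
Context {R : comPzRingType} {F : groupType}.
Local Notation H := (H1 F R).
Local Notation That := (tensor_hat H).

Definition tensor_hat_congr (p : nat) (s t : That) : Prop :=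
  tensor_hat_ideal p (s - t).

Definition tensor_hat_of_H (h : H) : That := thomog [:: h].

Record is_magnus_expansion (theta : F -> That) : Prop := IsMagnusExpansion {
  magnusM : forall a b : F, theta (a * b)%g = theta a * theta b;
  magnus_congr1 : forall a, tensor_hat_congr 1 (theta a) 1;
  magnus_congr2 : forall a,
    tensor_hat_congr 2 (theta a) (1 + tensor_hat_of_H (H1_class R a))
}.

Definition magnus_expansions : set (F -> That) := is_magnus_expansion.

(* The component of degree m of theta(a) only depends on a modulo I^(m+1); by  *)
(* magnus_hatE below, any representative of a modulo a power I^k with k > m    *)
(* can be used.                                                                *)
Definition magnus_hat (theta : F -> That) (a : group_ring_hat R F) : That :=
  TensorHat (fun m => tcompP (fmlift theta (qrepr (a m.+1))) m).

Lemma magnus_lift_ideal theta : is_magnus_expansion theta ->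
  forall m u, ideal_exp (aug_ideal R F) m u ->
    tensor_hat_ideal m (fmlift theta u).
Proof.
case=> thM th1 _.
have coef0 a : theta a 0%N = 1.
  by have /(_ 0%N isT) := th1 a; move/eqP; rewrite subr_eq0 => /eqP.
have liftM (u v : freemod R F) :
    fmlift theta (u * v) = fmlift theta u * fmlift theta v.
  elim/(@fm_ind R F): u => [|c k u IH]; first by rewrite !(mul0r, linear0).
  rewrite mulrDl !linearD /= IH mulrDl; congr (_ + _) => {IH}.
  rewrite -fm_scalerAl !linearZ /= -tensor_hat_scalerAl; congr (_ *: _).
  elim/(@fm_ind R F): v => [|b l v IH]; first by rewrite !(mulr0, linear0).
  rewrite mulrDr !linearD /= IH mulrDr; congr (_ + _) => {IH}.
  rewrite -fm_scalerAr !linearZ /= -tensor_hat_scalerAr; congr (_ *: _).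
  by rewrite -fmgenM !fmlift_gen thM.
have lift0 (u : freemod R F) : fmlift theta u 0%N = augmentation u *: (1 : tensor_alg H).
  elim/(@fm_ind R F): u => [|c k u IH].
    by rewrite linear0 augmentation0 scale0r.
  rewrite linearD linearZ augmentationD augmentationZ scalerDl -IH /=.
  by rewrite fmlift_gen coef0 augmentation_gen mulr1.
elim=> [|m IHm] u //= Iu.
elim: Iu => [|a _ b v [x [y [Ix Iy ->]]] _ IHv] k ltk.
  by rewrite linear0.
rewrite linearD [LHS]/= IHv // addr0 !liftM.
have Tx : tensor_hat_ideal 1 (fmlift theta x).
  by move=> [|//] _; rewrite lift0 Ix scale0r.
have T0 (t : That) : tensor_hat_ideal 0 t by [].
apply: (tensor_hat_idealM (tensor_hat_idealM (T0 _)
  (tensor_hat_idealM Tx (IHm y Iy))) (T0 _)).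
by rewrite addn0.
Qed.

Lemma magnus_hatE theta : is_magnus_expansion theta ->
  forall (a : group_ring_hat R F) k u, a k = qapi _ u ->
  forall m, (m < k)%N -> magnus_hat theta a m = fmlift theta u m.
Proof.
move=> magth a k u ak m ltmk.
have am1 : a m.+1 = qapi _ u.
  elim: k ltmk ak => [//|k IHk]; rewrite ltnS leq_eqVlt => /orP[/eqP<-//|ltmk].
  by move=> ak; apply: IHk => //; rewrite -cprojS ak qtrans_pi.
have /qapi_eq/(magnus_lift_ideal magth)/(_ m (leqnn _)) :
  qapi (aug_filtration R F m.+1) (qrepr (a m.+1)) = qapi _ u.
  by rewrite qapiK.
by rewrite linearB /= => /eqP; rewrite subr_eq0 => /eqP.
Qed.

Definition is_filtered_aut (U : That -> That) : Prop :=
  [/\ linear U, GRing.monoid_morphism U, bijective U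
    & forall p, (1 <= p)%N ->
        U @` tensor_hat_ideal (H := H) p = tensor_hat_ideal (H := H) p].

(* |U| = f, where T_1 / T_2 is identified with H by tensor_hat_of_H.           *)
Definition induces_on_H (U : That -> That) (f : H -> H) : Prop :=
  forall h, tensor_hat_congr 2 (U (tensor_hat_of_H h)) (tensor_hat_of_H (f h)).

Definition IA_tensor_hat : set (That -> That) :=
  [set U | is_filtered_aut U /\ induces_on_H U id].

End Magnus.

(* Main.v *)
Require Import Defs.
From HB Require Import structures.
From mathcomp Require Import all_boot all_algebra.
From mathcomp Require Import boolp classical_sets.

Import GRing.Theory.
Local Open Scope ring_scope.
Local Open Scope classical_set_scope.

(* Let I be the augmentation ideal. For any group F, sending [g] to g - 1
   identifies H_1(F; R) with I / I^2, so multiplication gives a surjection from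
   the m-th tensor power of H to I^m / I^(m+1). In degree m, an expansion theta
   maps (g_1 - 1)...(g_m - 1) to [g_1] (x) ... (x) [g_m], so it is a left
   inverse of this surjection, and both are isomorphisms. By completeness theta
   induces an isomorphism of the completions. Two expansions theta and theta'
   are then related by theta' o theta^-1, and by nothing else because
   theta(R[F]) is dense in the completed tensor algebra. *)

Lemma submemB (R : comPzRingType) (V : lmodType R) (N : submodule V) (u v : V) :
  N u -> N v -> N (u - v).
Proof.
by move=> Nu Nv; rewrite -scaleN1r; apply: submemD => //; apply: submemZ.
Qed.

(** * Powers of a two-sided ideal in a monoid algebra *)

Section IdealPowers.
Context {R : comPzRingType} {M : monoidType} (J : ideal R M).
Implicit Types (u v : freemod R M) (m p q : nat).

Lemma ideal_exp1 u : J u -> ideal_exp J 1 u.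
Proof.
move=> Ju; rewrite -[u]addr0 -[u]mul1r -[u]mulr1 mulrA.
by apply: ispanS; [exists u, 1; rewrite mulr1|apply: ispan0].
Qed.

(** Induction on [p]: in a generator of the first factor, all that stands to the right of [x],
    including [v], is gathered into one element, to which the induction hypothesis applies. *)
Lemma ideal_expM p q u v :
  ideal_exp J p u -> ideal_exp J q v -> ideal_exp J (p + q) (u * v).
Proof.
elim: p u v => [|p IH] u v /=; first by move=> _; apply: idealMl.
move=> Ju Jv; elim: Ju => [|a _ b w [x [y [Jx Jy ->]]] _ IHw].
  by rewrite mul0r; apply: ispan0.
rewrite mulrDl -!mulrA -[X in a * X]mulr1 mulrA.
apply: ispanS IHw; exists x, (y * (b * v)).
by split=> //; apply: IH => //; apply: idealMl.
Qed.

Lemma ideal_exp_sub p q u : (p <= q)%N -> ideal_exp J q u -> ideal_exp J p u.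
Proof.
move=> /subnK <-; elim: (q - p)%N => [//|d IH] /ideal_expS; exact: IH.
Qed.

(** The outer multipliers of [ispan] are absorbed, the left one into [x] and the right one into [y],
    so [P] only has to be stable under sums. *)
Lemma ideal_expS_ind m (P : freemod R M -> Prop) :
    P 0 -> (forall u v, P u -> P v -> P (u + v)) ->
    (forall x y, J x -> ideal_exp J m y -> P (x * y)) ->
  forall u, ideal_exp J m.+1 u -> P u.
Proof.
move=> P0 PD PM u; elim=> [//|a _ b v [x [y [Jx Jy ->]]] _ Pv].
apply: PD => //.
have -> : a * (x * y) * b = (a * x) * (y * b) by rewrite !mulrA.
by apply: PM; [apply: idealMl|apply: Defs.idealMr].
Qed.

End IdealPowers.

(** * Evaluating words in a map that is linear modulo J^2 *)

Section WordMap.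
Context {R : comPzRingType} {M : monoidType} (J : ideal R M) {H : lmodType R}.
Context {s : H -> freemod R M}.
Hypothesis sJ : forall h, J (s h).
Hypothesis s_linear : forall c h h',
  ideal_exp J 2 (s (c *: h + h') - (c *: s h + s h')).

Definition word_prod (w : words H) : freemod R M := \prod_(h <- w) s h.

(* s is only linear modulo J^2: word_map m, which kills the words of length *)
(* other than m, respects the tensor relations only modulo J^(m+1). *)
Definition word_map (m : nat) : freemod R (words H) -> freemod R M :=
  fmlift (fun w => if size w == m then word_prod w else 0).
HB.instance Definition _ m := GRing.Linear.copy (word_map m) (fmlift _).

Lemma word_map_gen m (w : words H) :
  word_map m (fmgen w) = if size w == m then word_prod w else 0.
Proof. exact: fmlift_gen. Qed.

Lemma word_prod_exp (w : words H) : ideal_exp J (size w) (word_prod w).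
Proof.
elim: w => [//|h w IH]; rewrite /word_prod big_cons -[size _]/(1 + size w)%N.
by apply: ideal_expM IH; apply: ideal_exp1.
Qed.

Lemma word_map_exp m W : ideal_exp J m (word_map m W).
Proof.
elim/(@fm_ind R (words H)): W => [|c w W IH].
  by rewrite linear0; apply: submem0.
rewrite linearD linearZ; apply: submemD IH; apply: submemZ.
rewrite [X in _ X]word_map_gen; case: eqP => [<-|_]; first exact: word_prod_exp.
exact: submem0.
Qed.

Lemma word_map_cons m h W :
  word_map m.+1 (fmgen ([:: h] : words H) * W) = s h * word_map m W.
Proof.
elim/(@fm_ind R (words H)): W => [|c w W IH].
  by rewrite !(mulr0, linear0).
rewrite mulrDr !linearD /= IH mulrDr -!fm_scalerAr !linearZ /= -fm_scalerAr.
congr (_ *: _ + _); rewrite -fmgenM !word_map_gen /= eqSS.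
by case: eqP; rewrite ?mulr0 // /word_prod big_cons.
Qed.

(** Between words [k] and [l] of total length m - 1, a tensor relation becomes a defect of linearity
    of [s]. This lies in J^2 and so gains one power of J over the single letter in its place. For
    other lengths the image is 0. *)
Lemma word_map_relation m W :
  ideal_span (@tensor_relation R H) W -> ideal_exp J m.+1 (word_map m W).
Proof.
have rel k l W0 : tensor_relation W0 ->
    ideal_exp J m.+1 (word_map m (fmgen k * W0 * fmgen l)).
  case=> c h h'.
  pose kl g : freemod R (words H) :=
    fmgen k * fmgen ([:: g] : words H) * fmgen l.
  have klE g : word_map m (kl g) =
      if (size k + 1 + size l)%N == m then word_prod k * s g * word_prod l
      else 0.
    rewrite /kl -!fmgenM word_map_gen !size_cat; case: eqP => // _.
    by rewrite /word_prod !big_cat big_seq1.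
  have -> : fmgen k * (fmgen ([:: c *: h + h'] : words H)
        - (c *: fmgen ([:: h] : words H) + fmgen ([:: h'] : words H)))
        * fmgen l = kl (c *: h + h') - (c *: kl h + kl h').
    rewrite mulrBr mulrDr mulrBl mulrDl.
    by rewrite -(fm_scalerAr c (fmgen k)) -(fm_scalerAl c _ (fmgen l)).
  have lin A B C A' B' C' : word_map m A = A' -> word_map m B = B' ->
      word_map m C = C' -> ideal_exp J m.+1 (A' - (c *: B' + C')) ->
      ideal_exp J m.+1 (word_map m (A - (c *: B + C))).
    by move=> <- <- <-; rewrite linearB (linearD _ (c *: B)) linearZ.
  apply: (lin _ _ _ _ _ _ (klE _) (klE _) (klE _)).
  case: eqP => [<-|_]; last by rewrite scaler0 addr0 subr0; apply: submem0.
  rewrite (fm_scalerAl c _ (word_prod l)) (fm_scalerAr c (word_prod k)).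
  rewrite -!mulrDl -mulrDr -mulrBl -mulrBr.
  have -> : (size k + 1 + size l).+1 = (size k + 2 + size l)%N.
    by rewrite addn1 addn2.
  apply: ideal_expM (word_prod_exp l).
  by apply: ideal_expM (s_linear c h h'); apply: word_prod_exp.
elim=> [|a W0 b W' /rel rel0 _ IH]; first by rewrite linear0; apply: submem0.
rewrite linearD; apply: submemD IH.
(* By linearity the multipliers [a] and [b] of the relation may be taken to be single words. *)
elim/(@fm_ind R (words H)): a => [|d k a IHa].
  by rewrite !mul0r linear0; apply: submem0.
rewrite !mulrDl linearD; apply: submemD IHa.
rewrite -!fm_scalerAl linearZ; apply: submemZ.
elim/(@fm_ind R (words H)): b => [|e l b IHb].
  by rewrite mulr0 linear0; apply: submem0.
rewrite mulrDr linearD; apply: submemD IHb.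
rewrite -fm_scalerAr linearZ; apply: submemZ.
exact: rel0.
Qed.

End WordMap.

(** * The isomorphism of I / I^2 with H_1 *)

Section HomologyClass.
Context {R : comPzRingType} {G : groupType}.
Local Notation I := (aug_ideal R G).
Local Notation RG := (freemod R G).

Lemma H1_classM (a b : G) : H1_class R (a * b)%g = H1_class R a + H1_class R b.
Proof.
rewrite /H1_class -aadd_abel /tensorZ_pair -linearD; apply/qpi_eq.
rewrite -[X in submem _ X]addr0 -[X in submem _ (X + _)]scale1r.
by apply: lspanS; [apply: TensorZDl|apply: lspan0].
Qed.

Lemma H1_class1 : H1_class R (1%g : G) = 0.
Proof.
by apply: (addrI (H1_class R (1%g : G))); rewrite -H1_classM mul1g addr0.
Qed.

Lemma tensorZ_pairE (a : abelianization G) (r : R) :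
  tensorZ_pair a r = r *: H1_class R (abel_repr a).
Proof.
rewrite /H1_class abel_reprK /tensorZ_pair -linearZ /= -[in LHS](mulr1 r).
apply/qpi_eq; rewrite -[X in submem _ X]addr0 -[X in submem _ (X + _)]scale1r.
by apply: lspanS; [apply: TensorZZ|apply: lspan0].
Qed.

(** On I this sends g - 1 to the class of g, since 1 goes to 0; it induces the isomorphism of I /
    I^2 with H_1. *)
Definition aug_class : RG -> H1 G R := fmlift (H1_class R).
HB.instance Definition _ := GRing.Linear.copy aug_class (fmlift (H1_class R)).

Lemma aug_class_gen g : aug_class (fmgen g) = H1_class R g.
Proof. exact: fmlift_gen. Qed.

Lemma aug_ideal_gen (g : G) : I (fmgen g - 1).
Proof.
rewrite /= -scaleN1r augmentationD augmentationZ !augmentation_gen mulr1.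
exact: subrr.
Qed.

Lemma aug_class1 : aug_class 1 = 0.
Proof. by rewrite [LHS]aug_class_gen H1_class1. Qed.

(** The symbol of a pair (a, r) is the class of r(g - 1) for g over a, and such symbols span H_1. *)
Lemma aug_class_surj (h : H1 G R) : exists2 u, I u & aug_class u = h.
Proof.
rewrite -[h]qreprK; elim/(@fm_ind R (abelianization G * R)%type): (qrepr h)
  => [|c [a r] v [u Iu Eu]].
  by exists 0; [apply: submem0|rewrite !linear0].
exists ((c * r) *: (fmgen (abel_repr a) - 1) + u).
  by apply: submemD => //; apply: submemZ; apply: aug_ideal_gen.
rewrite linearD linearZ linearB /= aug_class_gen aug_class1 subr0 Eu.
rewrite linearD linearZ -scalerA; congr (_ *: _ + _).
exact/esym/tensorZ_pairE.
Qed.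

Definition aug_quot (g : G) : quotalg (ideal_exp I 2) := qapi _ (fmgen g - 1).

(** The defect of additivity is (a - 1)(b - 1), a product of two elements of I. *)
Lemma aug_quotM (a b : G) : aug_quot (a * b)%g = aug_quot a + aug_quot b.
Proof.
rewrite /aug_quot -linearD; apply/qapi_eq.
have -> : fmgen (a * b)%g - 1 - ((fmgen a - 1) + (fmgen b - 1)) =
    (fmgen a - 1) * (fmgen b - 1) :> RG.
  rewrite fmgenM mulrBr mulrBl mulr1 mul1r.
  move: (fmgen a : RG) (fmgen b : RG) (1 : RG) => u v e.
  rewrite !opprD !opprK !addrA; congr (_ + _).
  by rewrite [_ - e - u]addrAC subrK addrAC.
by apply: (@ideal_expM R G I 1 1); apply: ideal_exp1; apply: aug_ideal_gen.
Qed.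

Lemma aug_quot1 : aug_quot 1%g = 0.
Proof. by apply: (addrI (aug_quot 1%g)); rewrite -aug_quotM mul1g addr0. Qed.

Lemma aug_quotV (a : G) : aug_quot a^-1%g = - aug_quot a.
Proof.
by apply: (addrI (aug_quot a)); rewrite -aug_quotM mulgV aug_quot1 subrr.
Qed.

(** A homomorphism to an additive group kills commutators, so [aug_quot] factors through the
    abelianization. *)
Lemma aug_quot_abel (a b : G) : abel a = abel b -> aug_quot a = aug_quot b.
Proof.
move=> /abel_eq D; apply/esym/eqP.
rewrite -subr_eq0 addrC -aug_quotV -aug_quotM.
elim: D => [x y|||] /=.
- by rewrite commgEl conjgE !aug_quotM !aug_quotV addrCA addKr addNr.
- by rewrite aug_quot1.
- by move=> x y _ /eqP Ex _ /eqP Ey; rewrite aug_quotM Ex Ey addr0.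
- by move=> x _ /eqP Ex; rewrite aug_quotV Ex oppr0.
Qed.

Definition abel_lift : RG -> freemod R (abelianization G * R)%type :=
  fmlift (fun g => fmgen (abel g, 1)).
HB.instance Definition _ := GRing.Linear.copy abel_lift
  (fmlift (fun g => fmgen (abel g, 1) : freemod R (abelianization G * R)%type)).

(** The inverse of the map induced by [aug_class], written on the free module that presents H_1;
    [abel_repr] chooses the group element. *)
Definition tensorZ_aug :
    freemod R (abelianization G * R)%type -> quotalg (ideal_exp I 2) :=
  fmlift (fun p => p.2 *: aug_quot (abel_repr p.1)).
HB.instance Definition _ := GRing.Linear.copy tensorZ_aug
  (fmlift (fun p => p.2 *: aug_quot (abel_repr p.1))).

Lemma tensorZ_aug_gen a r :
  tensorZ_aug (fmgen (a, r)) = r *: aug_quot (abel_repr a).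
Proof. exact: fmlift_gen. Qed.

(** This makes the inverse map descend to H_1: the first relation is additivity of [aug_quot], the
    other two are linearity in the scalar. *)
Lemma tensorZ_aug_relation W :
  lspan (@tensorZ_relation (abelianization G) R) W -> tensorZ_aug W = 0.
Proof.
have lin A B C A' B' C' : tensorZ_aug A = A' -> tensorZ_aug B = B' ->
    tensorZ_aug C = C' -> A' = B' + C' -> tensorZ_aug (A - (B + C)) = 0.
  by move=> <- <- <- EA; rewrite linearB (linearD _ B) /= EA subrr.
have scal d A B A' B' : tensorZ_aug A = A' -> tensorZ_aug B = B' ->
    A' = d *: B' -> tensorZ_aug (A - d *: B) = 0.
  by move=> <- <- EA; rewrite linearB linearZ /= EA subrr.
have rel V : tensorZ_relation V -> tensorZ_aug V = 0.
  case=> [a b r|a r r'|d a r].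
  - apply: (lin _ _ _ _ _ _
      (tensorZ_aug_gen _ _) (tensorZ_aug_gen _ _) (tensorZ_aug_gen _ _)).
    rewrite -scalerDr -aug_quotM; congr (_ *: _); apply: aug_quot_abel.
    by rewrite -aadd_abel !abel_reprK.
  - apply: (lin _ _ _ _ _ _
      (tensorZ_aug_gen _ _) (tensorZ_aug_gen _ _) (tensorZ_aug_gen _ _)).
    exact: scalerDl.
  - apply: (scal _ _ _ _ _ (tensorZ_aug_gen _ _) (tensorZ_aug_gen _ _)).
    by rewrite scalerA.
elim=> [|c V v /rel EV _ Ev]; first by rewrite linear0.
by rewrite linearD linearZ /= EV Ev scaler0 addr0.
Qed.

(** The kernel of [aug_class] on I is I^2, because [tensorZ_aug] after [abel_lift] sends v to v
    minus its augmentation, modulo I^2. *)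
Lemma aug_class_eq0 u : I u -> aug_class u = 0 -> ideal_exp I 2 u.
Proof.
move=> Iu u0; have Ev : forall v : RG, qpi _ (abel_lift v) = aug_class v.
  move=> v; elim/(@fm_ind R G): v => [|c g v IH]; first by rewrite !linear0.
  by rewrite !linearD !linearZ /= IH [abel_lift _]fmlift_gen aug_class_gen.
(* [abel_lift u] represents the class of [u], which is 0, so it lies in the span of the
   relations. *)
have {Ev} /tensorZ_aug_relation T0 :
    lspan (@tensorZ_relation (abelianization G) R) (abel_lift u).
  rewrite -[X in lspan _ X]subr0; apply/(qpi_eq (lspan_submodule _)).
  by rewrite linear0 -u0; exact: Ev.
have E v : tensorZ_aug (abel_lift v) =
    qapi (ideal_exp I 2) (v - augmentation v *: (1 : RG)).
  elim/(@fm_ind R G): v => [|c g v IH].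
    by rewrite augmentation0 scale0r subr0 !linear0.
  rewrite linearD /= linearD /= IH.
  rewrite augmentationD augmentationZ augmentation_gen mulr1.
  rewrite linearZ /= linearZ /= [abel_lift _]fmlift_gen tensorZ_aug_gen scale1r.
  rewrite (aug_quot_abel _ g) ?abel_reprK // -qapiZ -linearD; congr qapi.
  by rewrite scalerBr scalerDl opprD addrACA.
have /qapi_eq : qapi (ideal_exp I 2) u = qapi (ideal_exp I 2) 0.
  by rewrite linear0 -T0 E Iu scale0r subr0.
by rewrite subr0.
Qed.

End HomologyClass.

(** * Filtration and leading terms in the completed tensor algebra *)

Section TensorHat.
Context {R : comPzRingType} {H : lmodType R}.
Local Notation That := (tensor_hat H).
Implicit Types (s t : That) (m p q : nat).

Lemma tens1_linear (c : R) (h h' : H) :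
  tens [:: c *: h + h'] = c *: tens [:: h] + tens [:: h'].
Proof.
rewrite /tens -qapiZ -linearD; apply/qapi_eq.
rewrite -[X in submem _ X]addr0 -[X in submem _ (X + _)]mul1r.
rewrite -[X in submem _ (X + _)]mulr1.
by apply: ispanS; [apply: TensorRelation|apply: ispan0].
Qed.

Lemma tens1_0 : tens [:: (0 : H)] = 0.
Proof.
have := tens1_linear (- 1) 0 0; rewrite scaler0 addr0 scaleN1r => ->.
exact: addNr.
Qed.

Lemma tensor_hat_ideal0 p : tensor_hat_ideal p (0 : That).
Proof. by []. Qed.

Lemma tensor_hat_idealD p s t :
  tensor_hat_ideal p s -> tensor_hat_ideal p t -> tensor_hat_ideal p (s + t).
Proof. by move=> Ts Tt m ltm; rewrite /= Ts // Tt // addr0. Qed.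

Lemma tensor_hat_idealB p s t :
  tensor_hat_ideal p s -> tensor_hat_ideal p t -> tensor_hat_ideal p (s - t).
Proof. by move=> Ts Tt m ltm; rewrite /= Ts // Tt // subr0. Qed.

Lemma tensor_hat_ideal_sub p q t :
  (p <= q)%N -> tensor_hat_ideal q t -> tensor_hat_ideal p t.
Proof. by move=> lepq Tt m ltm; apply: Tt; apply: leq_trans lepq. Qed.

(** The filtration is separated, which turns congruences modulo every T_p into equalities. *)
Lemma tensor_hat_ideal_eq0 t : (forall p, tensor_hat_ideal p t) -> t = 0.
Proof. by move=> Tt; apply: tensor_hatP => m; apply: (Tt m.+1). Qed.

(** In the convolution sum an index other than p is below p, or its complement is below q, so one
    factor vanishes. *)
Lemma tensor_hat_lead_mul p q s t :
    tensor_hat_ideal p s -> tensor_hat_ideal q t ->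
  (s * t) (p + q)%N = s p * t q.
Proof.
move=> Ts Tt; have ltp : (p < (p + q).+1)%N by rewrite ltnS leq_addr.
rewrite [LHS]/= (bigD1 (Ordinal ltp)) //= addKn big1 ?addr0 // => i /eqP neip.
case: (ltngtP i p) => [ltip|ltpi|eqip]; first by rewrite Ts ?mul0r.
  by rewrite Tt ?mulr0 // ltn_subLR ?leq_ord // ltn_add2r.
by case: neip; apply: val_inj.
Qed.

End TensorHat.

(** * Leading terms of an expansion on the group ring *)

Section MagnusLift.
Context {R : comPzRingType} {F : groupType}.
Local Notation H := (H1 F R).
Local Notation That := (tensor_hat H).
Local Notation I := (aug_ideal R F).
Local Notation RF := (freemod R F).
Context (theta : F -> That) (magth : is_magnus_expansion theta).
Implicit Types (u v : RF) (t : That).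
Local Notation L := (fmlift theta).

Lemma magnus_liftM u v : L (u * v) = L u * L v.
Proof.
case: magth => thM _ _.
elim/(@fm_ind R F): u => [|c k u IH]; first by rewrite !(mul0r, linear0).
rewrite mulrDl !linearD /= IH mulrDl; congr (_ + _) => {IH}.
rewrite -fm_scalerAl !linearZ /= -tensor_hat_scalerAl; congr (_ *: _).
elim/(@fm_ind R F): v => [|b l v IH]; first by rewrite !(mulr0, linear0).
rewrite mulrDr !linearD /= IH mulrDr; congr (_ + _) => {IH}.
rewrite -fm_scalerAr !linearZ /= -tensor_hat_scalerAr; congr (_ *: _).
by rewrite -fmgenM !fmlift_gen thM.
Qed.

Lemma magnus_coef0 a : theta a 0%N = 1.
Proof.
by have [_ th1 _] := magth; move/eqP: (th1 a 0%N isT); rewrite subr_eq0 => /eqP.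
Qed.

Lemma magnus_coef1 a : theta a 1%N = tens [:: H1_class R a].
Proof.
have [_ _ th2] := magth; move/eqP: (th2 a 1%N isT).
by rewrite subr_eq0 => /eqP ->; rewrite /= /thomog_fun /= add0r.
Qed.

(* d = theta(1) - 1 satisfies d = - d^2 and so lies in all filtration steps. *)
Lemma magnus1 : theta 1%g = 1.
Proof.
have [thM th1 _] := magth; set d := theta 1%g - 1.
have Ed : d = - (d * d).
  rewrite /d mulrBr mulr1 mulrBl mul1r -thM mulg1.
  by rewrite subrr sub0r opprK.
apply/eqP; rewrite -subr_eq0 -/d; apply/eqP.
apply: tensor_hat_ideal_eq0 => p; have d1 := th1 1%g.
elim: p => [|p IH]; first by [].
rewrite Ed -sub0r; apply: tensor_hat_idealB; first exact: tensor_hat_ideal0.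
by rewrite -add1n; apply: tensor_hat_idealM.
Qed.

Lemma magnus_lift1 : L 1 = 1.
Proof. by rewrite [LHS]fmlift_gen magnus1. Qed.

Lemma magnus_lift_deg0 u : L u 0%N = augmentation u *: (1 : tensor_alg H).
Proof.
elim/(@fm_ind R F): u => [|c k u IH].
  by rewrite linear0 augmentation0 scale0r.
rewrite linearD linearZ augmentationD augmentationZ scalerDl -IH /=.
by rewrite fmlift_gen magnus_coef0 augmentation_gen mulr1.
Qed.

Lemma magnus_lift_deg1 u : L u 1%N = tens [:: aug_class u].
Proof.
elim/(@fm_ind R F): u => [|c k u IH]; first by rewrite !linear0 tens1_0.
rewrite linearD linearZ [in RHS]linearD [in RHS]linearZ /= IH fmlift_gen.
by rewrite magnus_coef1 aug_class_gen tens1_linear.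
Qed.

Lemma magnus_lift_lead p q u v : ideal_exp I p u -> ideal_exp I q v ->
  L (u * v) (p + q)%N = L u p * L v q.
Proof.
move=> Iu Iv; rewrite magnus_liftM.
by apply: tensor_hat_lead_mul; apply: magnus_lift_ideal.
Qed.

(** Modulo I^(m+1), [u] is recovered from its leading term by substituting [s] into a combination of
    words [W] that represents this tensor. For a product xy with x in I, the letter [x] is put in
    front of the [W] of y. *)
Lemma magnus_lift_word_map (s : H -> RF) m u :
    (forall h, I (s h)) ->
    (forall x, I x -> ideal_exp I 2 (s (aug_class x) - x)) ->
    ideal_exp I m u ->
  exists2 W, qapi (ideal_span (@tensor_relation R H)) W = L u m
    & ideal_exp I m.+1 (word_map (s := s) m W - u).
Proof.
move=> sI sK; elim: m u => [|m IHm] u.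
  (* In degree 0, [W] is the empty word times the augmentation of [u], and the error lies in I. *)
  move=> _; exists (augmentation u *: (1 : freemod R (words H))).
    by rewrite magnus_lift_deg0 qapiZ rmorph1.
  rewrite linearZ /= [word_map _ _]word_map_gen /= /word_prod big_nil.
  apply: (@ideal_exp1 R F I); rewrite /= -scaleN1r augmentationD !augmentationZ.
  by rewrite [augmentation 1]augmentation_gen mulr1 mulN1r subrr.
move: u; apply: (@ideal_expS_ind R F I m (fun u => exists2 W,
    qapi (ideal_span (@tensor_relation R H)) W = L u m.+1
    & ideal_exp I m.+2 (word_map (s := s) m.+1 W - u)))
  => [|v v' [W EW IW] [W' EW' IW']|x y Ix Iy].
- exists 0; first by rewrite !linear0.
  by rewrite subr0 linear0; apply: submem0.
- exists (W + W'); first by rewrite linearD /= EW EW' linearD.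
  by rewrite linearD opprD addrACA; apply: submemD.
have [W EW IW] := IHm y Iy.
exists (fmgen ([:: aug_class x] : words H) * W).
  rewrite qapiM EW -[in RHS]add1n (@magnus_lift_lead 1 m) //.
    by rewrite magnus_lift_deg1.
  exact: ideal_exp1.
rewrite word_map_cons.
(* The first error term lies in I^2 times I^m, the second in I times I^(m+1). *)
have -> : s (aug_class x) * word_map (s := s) m W - x * y =
    (s (aug_class x) - x) * word_map (s := s) m W
    + x * (word_map (s := s) m W - y).
  by rewrite mulrBl mulrBr addrA subrK.
apply: submemD; last first.
  by rewrite -add1n; apply: ideal_expM => //; apply: ideal_exp1.
by rewrite -add2n; apply: ideal_expM; [apply: sK|apply: word_map_exp].
Qed.

(** A representative [W] of the vanishing leading term lies in the ideal of tensor relations, so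
    substitution sends it into I^(m+1), and the result differs from [u] by an element of I^(m+1). *)
Lemma magnus_lift_lead_eq0 m u :
  ideal_exp I m u -> L u m = 0 -> ideal_exp I m.+1 u.
Proof.
move=> Iu u0.
(* [s] is a pointwise choice of preimages in I. It is linear, and inverts [aug_class], modulo I^2,
   because both defects lie in I and have class 0. *)
have [s sP] : {s : H -> RF & forall h, I (s h) /\ aug_class (s h) = h}.
  apply: (@boolp.choice H RF (fun h v => I v /\ aug_class v = h)) => h.
  by have [v Iv Ev] := aug_class_surj h; exists v.
have sI h := (sP h).1; have sE h := (sP h).2.
have sK x : I x -> ideal_exp I 2 (s (aug_class x) - x).
  move=> Ix; apply: aug_class_eq0; first exact: submemB.
  by rewrite linearB /= sE subrr.
have s_linear c h h' : ideal_exp I 2 (s (c *: h + h') - (c *: s h + s h')).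
  apply: aug_class_eq0.
    by apply: submemB => //; apply: submemD => //; apply: submemZ.
  by rewrite linearB linearD linearZ /= !sE subrr.
have [W EW IW] := magnus_lift_word_map s m u sI sK Iu.
rewrite -[u](subKr (word_map (s := s) m W)); apply: submemB => //.
apply: word_map_relation => //; rewrite -[W]subr0; apply/qapi_eq.
by rewrite EW u0 linear0.
Qed.

(** Converse of [magnus_lift_ideal], climbing one degree at a time: I^m is exactly the preimage of
    T_m. *)
Lemma magnus_lift_idealE m u : tensor_hat_ideal m (L u) -> ideal_exp I m u.
Proof.
elim: m => [//|m IHm] Tu; apply: magnus_lift_lead_eq0; last exact: Tu.
by apply: IHm; apply: tensor_hat_ideal_sub Tu.
Qed.

(** A pure tensor of h_1, ..., h_m is the leading term of x_1 ... x_m, where x_i in I has class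
    h_i. *)
Lemma magnus_lift_lead_surj m (t : tensor_alg H) : tensor_power H m t ->
  exists2 u, ideal_exp I m u & L u m = t.
Proof.
elim=> [|c _ t' [w [<- ->]] _ [u Iu Eu]].
  by exists 0; [apply: submem0|rewrite linear0].
have [v Iv Ev] : exists2 v, ideal_exp I (size w) v & L v (size w) = tens w.
  elim: w {u Iu Eu} => [|h w [v Iv Ev]].
    by exists 1; rewrite ?magnus_lift1.
  have [x /ideal_exp1 Ix Ex] := aug_class_surj h.
  exists (x * v); rewrite -[size (h :: w)]/(1 + size w)%N.
    exact: ideal_expM.
  by rewrite magnus_lift_lead // Ev magnus_lift_deg1 Ex -tens_cat.
exists (c *: v + u); first by apply: submemD => //; apply: submemZ.
by rewrite linearD linearZ /= Ev Eu.
Qed.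

(** The error is corrected degree by degree: its component of degree m is the leading term of some v
    in I^m. *)
Lemma magnus_lift_approx p m t : tensor_hat_ideal p t ->
  exists2 u, ideal_exp I p u & tensor_hat_ideal m (t - L u).
Proof.
move=> Tt; elim: m => [|m [u Iu Tu]]; first by exists 0; [apply: submem0|].
case: (ltnP m p) => [ltmp|lepm].
  (* Until degree p is reached, [t] is already small enough, and taking 0 keeps [u] in I^p. *)
  exists 0; first exact: submem0.
  by rewrite linear0 subr0; apply: tensor_hat_ideal_sub Tt.
have [v Iv Ev] := magnus_lift_lead_surj m _ (tcompP (t - L u) m).
exists (u + v); first by apply: submemD => //; apply: ideal_exp_sub Iv.
have Tv := magnus_lift_ideal magth Iv.
rewrite linearD opprD addrA => k; rewrite ltnS leq_eqVlt => /orP[/eqP->|ltkm].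
  by rewrite -[LHS]/((t - L u) m - L v m) -Ev subrr.
by rewrite -[LHS]/((t - L u) k - L v k) Tu // Tv // subr0.
Qed.

End MagnusLift.

(** * The induced isomorphism of completions *)

Section MagnusHat.
Context {R : comPzRingType} {F : groupType}.
Local Notation H := (H1 F R).
Local Notation That := (tensor_hat H).
Local Notation I := (aug_ideal R F).
Local Notation RF := (freemod R F).
Local Notation RFhat := (group_ring_hat R F).
Context (theta : F -> That) (magth : is_magnus_expansion theta).
Implicit Types (u v : RF) (t : That) (a b : RFhat).
Local Notation L := (fmlift theta).

Definition group_ring_embed u : RFhat :=
  Completion (fun m => @qtrans_pi R F (aug_filtration R F) m u).

Lemma magnus_hat_embed u : magnus_hat theta (group_ring_embed u) = L u.
Proof.
by apply: tensor_hatP => m; apply: (magnus_hatE magth (k := m.+1)).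
Qed.

(** One representative serves all degrees up to m at once, as multiplicativity requires: degree m of
    a product involves all lower degrees. *)
Lemma magnus_hat_coef a m : exists2 u, a m.+1 = qapi _ u &
  forall k, (k <= m)%N -> magnus_hat theta a k = L u k.
Proof.
exists (qrepr (a m.+1)); first by rewrite qapiK.
by move=> k lekm; apply: (magnus_hatE magth (k := m.+1)); rewrite ?qapiK.
Qed.

Lemma magnus_hat_linear : linear (magnus_hat theta).
Proof.
move=> c a b; apply: tensor_hatP => m.
have [u au Eu] := magnus_hat_coef a m; have [v bv Ev] := magnus_hat_coef b m.
rewrite (@magnus_hatE _ _ _ magth _ m.+1 (c *: u + v)) //.
  move: (magnus_hat theta a) (magnus_hat theta b) Eu Ev => s t Es Et.
  by rewrite linearD linearZ /= Es // Et.
by rewrite linearD linearZ /= -au -bv.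
Qed.

Lemma magnus_hat_monoid_morphism : GRing.monoid_morphism (magnus_hat theta).
Proof.
split=> [|a b].
  have -> : 1 = group_ring_embed 1.
    by apply: completionP => m; rewrite /= rmorph1.
  by rewrite magnus_hat_embed magnus_lift1.
apply: tensor_hatP => m.
have [u au Eu] := magnus_hat_coef a m; have [v bv Ev] := magnus_hat_coef b m.
rewrite (@magnus_hatE _ _ _ magth _ m.+1 (u * v)) //; last first.
  by rewrite qapiM -au -bv.
move: (magnus_hat theta a) (magnus_hat theta b) Eu Ev => s t Es Et.
rewrite magnus_liftM //=; apply: eq_bigr => i _.
by rewrite Es ?leq_ord // Et ?leq_subr.
Qed.

Lemma magnus_hat_filt p a :
  aug_ideal_hat p a -> tensor_hat_ideal p (magnus_hat theta a).
Proof.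
move=> /(_ p (leqnn p)) [u Iu au] k ltkp.
by rewrite (magnus_hatE magth au ltkp); apply: (magnus_lift_ideal magth Iu).
Qed.

(** Approximations of [t] modulo T_m, taken in I^p, form a compatible sequence: the images of
    consecutive ones differ by an element of T_m, so they differ by an element of I^m. *)
Lemma magnus_hat_surj p t : tensor_hat_ideal p t ->
  exists2 a, aug_ideal_hat p a & magnus_hat theta a = t.
Proof.
move=> Tt; have [u uP] : {u : nat -> RF & forall m,
    ideal_exp I p (u m) /\ tensor_hat_ideal m (t - L (u m))}.
  apply: (@boolp.choice nat RF (fun m v =>
    ideal_exp I p v /\ tensor_hat_ideal m (t - L v))) => m.
  by have [v Iv Tv] := magnus_lift_approx _ magth p m t Tt; exists v.
have uS m : qtrans (qapi (aug_filtration R F m.+1) (u m.+1)) =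
    qapi (aug_filtration R F m) (u m).
  rewrite qtrans_pi; apply/qapi_eq/(magnus_lift_idealE _ magth).
  have -> : L (u m.+1 - u m) = (t - L (u m)) - (t - L (u m.+1)).
    by rewrite linearB opprB [RHS]addrC addrA subrK.
  apply: tensor_hat_idealB; first exact: (uP m).2.
  exact: tensor_hat_ideal_sub (uP m.+1).2.
exists (Completion uS).
  by move=> m _; exists (u m) => //; apply: (uP m).1.
(* Degree m is read at level m + 1, where [u m.+1] is correct in all degrees up to m. *)
apply: tensor_hatP => m; rewrite (@magnus_hatE _ _ _ magth _ m.+1 (u m.+1)) //.
have /eqP := (uP m.+1).2 m (leqnn _).
by rewrite subr_eq0 => /eqP.
Qed.

(** Representatives at level m have the same image below degree m, hence differ by an element of
    I^m. *)
Lemma magnus_hat_inj : injective (magnus_hat theta).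
Proof.
move=> a b Eab; apply: completionP => m.
have [u au _] := cprojP a m; have [v bv _] := cprojP b m.
rewrite au bv; apply/qapi_eq/(magnus_lift_idealE _ magth) => k ltkm.
rewrite linearB -[LHS]/(L u k - L v k).
by rewrite -(magnus_hatE magth au ltkm) -(magnus_hatE magth bv ltkm) Eab subrr.
Qed.

Lemma magnus_hat_image p :
  magnus_hat theta @` aug_ideal_hat p = tensor_hat_ideal p.
Proof.
rewrite eqEsubset; split=> [_ [a Ia <-]|t Tt]; first exact: magnus_hat_filt.
by have [a Ia Ea] := magnus_hat_surj _ _ Tt; exists a.
Qed.

Lemma magnus_hat_bij : bijective (magnus_hat theta).
Proof.
have hat_surj t : exists a, magnus_hat theta a = t.
  (* T_0 is the whole algebra, so p = 0 gives surjectivity. *)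
  by have [a _ Ea] := magnus_hat_surj 0 t (fun _ => ltac:(done)); exists a.
have [g gK] := boolp.choice hat_surj.
by exists g => // a; apply: magnus_hat_inj; rewrite gK.
Qed.

End MagnusHat.

(** * Filtered automorphisms acting on expansions *)

Section FilteredAut.
Context {R : comPzRingType} {F : groupType}.
Local Notation H := (H1 F R).
Local Notation That := (tensor_hat H).
Local Notation RF := (freemod R F).
Implicit Types (U V : That -> That) (theta : F -> That) (t : That).

Lemma filtered_aut_ideal U p t : is_filtered_aut U ->
  (1 <= p)%N -> tensor_hat_ideal p t -> tensor_hat_ideal p (U t).
Proof. by case=> _ _ _ UT p_gt0 Tt; rewrite -(UT p p_gt0); exists t. Qed.

Lemma filtered_autD U s t : is_filtered_aut U -> U (s + t) = U s + U t.
Proof. by case=> Ulin _ _ _; rewrite -[s in LHS]scale1r Ulin scale1r. Qed.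

Lemma filtered_aut0 U : is_filtered_aut U -> U 0 = 0.
Proof.
by move=> Uaut; apply: (addrI (U 0)); rewrite -filtered_autD // !addr0.
Qed.

Lemma filtered_autB U s t : is_filtered_aut U -> U (s - t) = U s - U t.
Proof.
by move=> Uaut; apply: (addIr (U t)); rewrite -filtered_autD // !subrK.
Qed.

Lemma filtered_autZ U c t : is_filtered_aut U -> U (c *: t) = c *: U t.
Proof.
move=> Uaut; case: (Uaut) => Ulin _ _ _.
by rewrite -[c *: t]addr0 Ulin filtered_aut0 ?addr0.
Qed.

Lemma filtered_aut_lift U theta (u : RF) : is_filtered_aut U ->
  U (fmlift theta u) = fmlift (U \o theta) u.
Proof.
move=> Uaut; elim/(@fm_ind R F): u => [|c g u IH].
  by rewrite !linear0 filtered_aut0.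
rewrite linearD linearZ [in RHS]linearD [in RHS]linearZ /= !fmlift_gen -IH.
by rewrite (filtered_autD U) // (filtered_autZ U).
Qed.

(** Density and continuity: [U] and [V] agree on an approximation of [t], and both keep the
    remainder in T_(p+1). *)
Lemma magnus_filtered_aut_eq U V theta : is_magnus_expansion theta ->
  is_filtered_aut U -> is_filtered_aut V -> U \o theta = V \o theta -> U = V.
Proof.
move=> magth Uaut Vaut UV; apply/funext => t; apply/eqP; rewrite -subr_eq0.
apply/eqP/tensor_hat_ideal_eq0 => p.
(* Filtered automorphisms are only required to preserve T_p for p >= 1, hence the shift to p + 1. *)
apply: (@tensor_hat_ideal_sub _ _ _ p.+1) => //.
have T0 : tensor_hat_ideal 0 t by [].
have [u _ Tu] := magnus_lift_approx _ magth 0 p.+1 t T0.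
have -> : U t - V t = U (t - fmlift theta u) - V (t - fmlift theta u).
  rewrite (filtered_autB U) // (filtered_autB V) //.
  rewrite (filtered_aut_lift U) // (filtered_aut_lift V) // UV.
  by rewrite [X in _ = _ + X]opprB addrA subrK.
by apply: tensor_hat_idealB; apply: filtered_aut_ideal.
Qed.

Lemma magnus_IA_comp U theta :
  IA_tensor_hat U -> is_magnus_expansion theta ->
  is_magnus_expansion (U \o theta).
Proof.
case=> Uaut UH [thM th1 th2]; have [_ [U1 UM] _ _] := Uaut.
split=> [a b|a|a]; first by rewrite /= thM UM.
  rewrite /tensor_hat_congr -U1 -filtered_autB //.
  by apply: filtered_aut_ideal => //; apply: th1.
set h := H1_class R a; rewrite /tensor_hat_congr.
(* The first term is small because [U] preserves T_2, the second because [U] induces the identity on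
   H. *)
have -> : (U \o theta) a - (1 + tensor_hat_of_H h) =
    U (theta a - (1 + tensor_hat_of_H h))
    + (U (tensor_hat_of_H h) - tensor_hat_of_H h).
  rewrite (filtered_autB U) // (filtered_autD U) // U1 !opprD.
  by rewrite !addrA subrK.
apply: tensor_hat_idealD; last exact: UH.
by apply: filtered_aut_ideal => //; apply: th2.
Qed.

Lemma magnus_IA_exists theta theta' :
    is_magnus_expansion theta -> is_magnus_expansion theta' ->
  exists2 U, IA_tensor_hat U & U \o theta = theta'.
Proof.
move=> mag mag'.
have [g hK gK] := magnus_hat_bij _ mag.
have [g' hK' gK'] := magnus_hat_bij _ mag'.
have lin := magnus_hat_linear _ mag.
have [hat1 hatM] := magnus_hat_monoid_morphism _ mag.
have lin' := magnus_hat_linear _ mag'.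
have [hat1' hatM'] := magnus_hat_monoid_morphism _ mag'.
(* [U] goes back along the isomorphism of [theta] and forward along that of [theta']. *)
pose U t := magnus_hat theta' (g t).
have Ulift u : U (fmlift theta u) = fmlift theta' u.
  by rewrite -(magnus_hat_embed _ mag) /U hK magnus_hat_embed.
have Uaut : is_filtered_aut U.
  split.
  - move=> c s t; rewrite /U -lin'; congr magnus_hat.
    by apply: (can_inj hK); rewrite lin !gK.
  - split=> [|s t]; first by rewrite /U -hat1 hK hat1'.
    rewrite /U -hatM'; congr magnus_hat.
    by apply: (can_inj hK); rewrite hatM !gK.
  - exists (fun t => magnus_hat theta (g' t)) => t;
      by rewrite /U ?hK' ?gK ?hK ?gK'.
  (* T_p is the image of the same completed ideal under both isomorphisms. *)
  - move=> p _; rewrite -{1}(magnus_hat_image _ mag p).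
    rewrite -(magnus_hat_image _ mag' p) image_comp.
    by apply: eq_imagel => a _; rewrite /U /= hK.
exists U; last first.
  by apply/funext => a; rewrite /= -[theta a]fmlift_gen Ulift fmlift_gen.
split=> // h; have [x Ix Ex] := aug_class_surj h.
(* Under either expansion the image of [x] agrees with [h] modulo T_2, and [U] carries one image to
   the other. *)
have lead th : is_magnus_expansion th ->
    tensor_hat_ideal 2 (tensor_hat_of_H h - fmlift th x).
  move=> magth [|[|//]] _; rewrite -[LHS]/(tensor_hat_of_H h _ - fmlift th x _).
    by rewrite (magnus_lift_deg0 _ magth) Ix scale0r subr0.
  by rewrite (magnus_lift_deg1 _ magth) Ex subrr.
rewrite /tensor_hat_congr.
have -> : U (tensor_hat_of_H h) - tensor_hat_of_H (id h) =
    U (tensor_hat_of_H h - fmlift theta x)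
    - (tensor_hat_of_H h - fmlift theta' x).
  by rewrite (filtered_autB U) // Ulift opprB addrA subrK.
by apply: tensor_hat_idealB; [apply: filtered_aut_ideal => //|]; apply: lead.
Qed.

End FilteredAut.

Theorem theorem1p3 (R : comPzRingType) (n : nat) (hn : (2 <= n)%N)
    (F : groupType) (x : 'I_n -> F) (hF : free_on x) :
  let Theta : set (F -> tensor_hat (H1 F R)) := magnus_expansions in
  let IA : set (tensor_hat (H1 F R) -> tensor_hat (H1 F R)) := IA_tensor_hat in
  (forall theta, Theta theta ->
    [/\ linear (magnus_hat theta),
        GRing.monoid_morphism (magnus_hat theta),
        bijective (magnus_hat theta)
      & forall p, (1 <= p)%N ->
          magnus_hat theta @` aug_ideal_hat p = tensor_hat_ideal p])
  /\
  ((forall theta' theta'', Theta theta' -> Theta theta'' ->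
      exists! U, IA U /\ theta'' = U \o theta')
   /\
   [/\ forall U theta, IA U -> Theta theta -> Theta (U \o theta),
       forall U theta, IA U -> Theta theta -> U \o theta = theta -> U = id
     & forall theta' theta'', Theta theta' -> Theta theta'' ->
         exists2 U, IA U & U \o theta' = theta'']).
Proof.
move=> Theta IA; split=> [theta mag|].
  split; first exact: magnus_hat_linear.
  - exact: magnus_hat_monoid_morphism.
  - exact: magnus_hat_bij.
  - by move=> p _; apply: magnus_hat_image.
split=> [theta' theta'' mag' mag''|].
  have [U UIA UE] := magnus_IA_exists _ _ mag' mag''.
  exists U; split=> // V [VIA VE].
  apply: (magnus_filtered_aut_eq _ _ _ mag' UIA.1 VIA.1).
  by rewrite UE.
split=> [U theta|U theta UIA mag UE|]; first exact: magnus_IA_comp.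
  (* Freeness is uniqueness relative to the identity, which remains to be checked to be a filtered
     automorphism. *)
  apply: (magnus_filtered_aut_eq _ _ _ mag UIA.1); last by rewrite UE.
  split=> //; first by exists id.
  by move=> p _; rewrite image_id.
exact: magnus_IA_exists.
Qed.
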